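(* Let $n = m\lambda$ and $b$ be positive integers (with $m,\lambda$ positive integers), and let $F_1,\ldots,F_b$ be $b$ $FPA_\lambda(n,d)$'s (not necessarily different). Let $C$ be an $FPA_n(bn,c)$ of size $N$, where $c \geq bd$. Then there exists an $FPA_\lambda(bn,bd)$ of size $N \min_{1 \leq i \leq b} |F_i|$.
   Context: A $\lambda$-permutation of length $n$ (where $\lambda$ divides $n$) is an arrangement (sequence of length $n$) of the multiset consisting of $n/\lambda$ distinct symbols, each repeated exactly $\lambda$ times. The distance between two $\lambda$-permutations is the Hamming distance, i.e. the number of positions in which they disagree. A frequency permutation array $FPA_\lambda(n,d)$ is a set $T$ of $\lambda$-permutations of length $n$ (on a common set of $n/\lambda$ symbols) such that any two distinct members of $T$ have distance at least $d$; its size is $|T|$. *)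

(* Defs.v *)
From mathcomp Require Import all_boot.
Set Implicit Arguments.
Unset Strict Implicit.
Unset Printing Implicit Defensive.

Definition hamming (n : nat) (A : eqType) (u v : n.-tuple A) : nat :=
  #|[set i : 'I_n | tnth u i != tnth v i]|.

(* The symbol set is the whole finite type [A]. *)
Definition lambda_permutation (lam n : nat) (A : finType) (w : n.-tuple A) : Prop :=
  [/\ lam %| n, #|A| = n %/ lam & forall a : A, count_mem a w = lam].

(* [FPA_lam(n, d)].  The conditions relating [lam], [n] and [A] are repeated
   here so that they also hold when [T] is empty. *)
Definition is_FPA (lam n d : nat) (A : finType) (T : {set n.-tuple A}) : Prop :=
  [/\ lam %| n,
      #|A| = n %/ lam,
      forall w, w \in T -> lambda_permutation lam w
    & forall u v, u \in T -> v \in T -> u != v -> d <= hamming u v].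

(* Main.v *)
(** Write [F] for any one of the [F_i]; the same [F] can serve for every symbol
    of [C].  In a word [w] of [C], replace the [j]-th occurrence of a symbol [a]
    by the pair [(a, f_j)], where [f] is a word of [F].  Since each of the [b]
    symbols of [w] occurs [n] times, the positions of [w] correspond bijectively
    to pairs (symbol, occurrence index), so the new word contains [b] full copies
    of [f].  Words built from the same [w] and from distinct [f], [g] are at
    distance [b] times that of [f] and [g]; words built from distinct [w] already
    differ in their first coordinates as much as the words of [C] do. *)
Require Import Defs.
From mathcomp Require Import all_boot.
Set Implicit Arguments.
Unset Strict Implicit.
Unset Printing Implicit Defensive.

Lemma count_tuple (n : nat) (A : Type) (P : pred A) (w : n.-tuple A) :
  count P w = #|[set i | P (tnth w i)]|.
Proof. by rewrite -sum1_count big_tuple -sum1dep_card. Qed.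

Lemma card_preim_bij (I J : finType) (f : I -> J) (P : pred J) :
  bijective f -> #|[set i | P (f i)]| = #|[set j | P j]|.
Proof.
move=> f_bij; rewrite -(card_imset _ (bij_inj f_bij)); apply: eq_card => j.
case: f_bij => g fK gK; rewrite inE; apply/imsetP/idP => [[i + ->]|Pj].
  by rewrite inE.
by exists (g j); rewrite ?inE gK.
Qed.

Lemma card_prod_pred (I J : finType) (P : pred I) (Q : pred J) :
  #|[set q : I * J | P q.1 && Q q.2]| = #|[set i | P i]| * #|[set j | Q j]|.
Proof. by rewrite -cardsX; apply: eq_card => q; rewrite !inE. Qed.

(** The longer prefix contains position [i] itself, which adds one occurrence of that symbol. *)
Lemma ltn_count_take (A : eqType) (x0 : A) (s : seq A) (i j : nat) :
  i < j -> i < size s ->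
  count_mem (nth x0 s i) (take i s) < count_mem (nth x0 s i) (take j s).
Proof.
move=> ij i_s; rewrite -(subnKC ij) takeD (take_nth x0 i_s) count_cat.
by rewrite -cats1 count_cat /= eqxx -addnA -addn1 leq_add2l.
Qed.

(** Occurrences are numbered from 0, by counting in the prefix strictly before [p]. The default of
    [insubd] only makes the map total: it is never reached when every symbol occurs [n] times. *)
Definition slot (L n : nat) (n_gt0 : 0 < n) (B : finType) (w : L.-tuple B)
    (p : 'I_L) : B * 'I_n :=
  (tnth w p, insubd (Ordinal n_gt0) (count_mem (tnth w p) (take p w))).

Lemma slot_inj (L n : nat) (n_gt0 : 0 < n) (B : finType) (w : L.-tuple B) :
  (forall a, count_mem a w = n) -> injective (slot n_gt0 w).
Proof.
move=> w_count p q [eq_a /(congr1 val)].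
(* The prefix before [r] misses the occurrence at [r], so [insubd] returns the true count. *)
have lt_tn (r : 'I_L) : count_mem (tnth w r) (take r w) < n.
  have := @ltn_count_take _ (tnth w r) w r (size w).
  by rewrite take_size -tnth_nth w_count size_tuple ltn_ord; apply.
rewrite !val_insubd !lt_tn => eq_c; apply: val_inj => /=.
wlog lt_pq : p q eq_a eq_c / p < q => [IH|].
  case: (ltngtP p q) => // [|lt_qp]; first exact: IH.
  by apply/esym/IH.
have := @ltn_count_take _ (tnth w p) w p q lt_pq.
rewrite size_tuple ltn_ord -tnth_nth eq_c -eq_a ltnn.
by move/(_ isT).
Qed.

Lemma slot_bij (L n : nat) (n_gt0 : 0 < n) (B : finType) (w : L.-tuple B) :
  (forall a, count_mem a w = n) -> L = #|B| * n -> bijective (slot n_gt0 w).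
Proof.
move=> w_count L_eq; apply: inj_card_bij (slot_inj w_count) _.
by rewrite card_prod !card_ord L_eq.
Qed.

Definition fill (L n : nat) (n_gt0 : 0 < n) (A B : finType) (w : L.-tuple B)
    (f : n.-tuple A) : L.-tuple (B * A) :=
  [tuple ((slot n_gt0 w p).1, tnth f (slot n_gt0 w p).2) | p < L].

(** Counting over slots instead of positions, the entry [(a, x)] comes exactly from the slots
    [(a, j)] with [tnth f j = x]. *)
Lemma count_fill (L n : nat) (n_gt0 : 0 < n) (A B : finType) (w : L.-tuple B)
    (f : n.-tuple A) (a : B) (x : A) :
  (forall a, count_mem a w = n) -> L = #|B| * n ->
  count_mem (a, x) (fill n_gt0 w f) = count_mem x f.
Proof.
move=> w_count L_eq; rewrite !count_tuple.
under eq_finset => p do rewrite tnth_mktuple.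
rewrite (card_preim_bij (fun q => (q.1, tnth f q.2) == (a, x))
                        (slot_bij n_gt0 w_count L_eq)).
under eq_finset => q do rewrite xpair_eqE.
by rewrite (card_prod_pred (pred1 a) (fun j => tnth f j == x)) cardsE card1 mul1n.
Qed.

Lemma hamming_fill_same (L n : nat) (n_gt0 : 0 < n) (A B : finType)
    (w : L.-tuple B) (f g : n.-tuple A) :
  (forall a, count_mem a w = n) -> L = #|B| * n ->
  hamming (fill n_gt0 w f) (fill n_gt0 w g) = #|B| * hamming f g.
Proof.
move=> w_count L_eq; rewrite /hamming.
under eq_finset => p do rewrite !tnth_mktuple xpair_eqE eqxx /=.
rewrite (card_preim_bij (fun q => tnth f q.2 != tnth g q.2)
                        (slot_bij n_gt0 w_count L_eq)).
rewrite (card_prod_pred predT (fun j => tnth f j != tnth g j)).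
by rewrite cardsT.
Qed.

Lemma hamming_fill_ge (L n : nat) (n_gt0 : 0 < n) (A B : finType)
    (v w : L.-tuple B) (f g : n.-tuple A) :
  hamming v w <= hamming (fill n_gt0 v f) (fill n_gt0 w g).
Proof.
apply/subset_leq_card/subsetP => p; rewrite !inE !tnth_mktuple xpair_eqE /=.
by move=> /negPf ->.
Qed.

(** First coordinates give back the outer word; any single symbol [a] then suffices to read off the
    whole inner word. *)
Lemma fill_inj (L n : nat) (n_gt0 : 0 < n) (A B : finType)
    (v w : L.-tuple B) (f g : n.-tuple A) :
  0 < #|B| -> (forall a, count_mem a w = n) -> L = #|B| * n ->
  fill n_gt0 v f = fill n_gt0 w g -> v = w /\ f = g.
Proof.
move=> /card_gt0P[a _] w_count L_eq eq_fill.
have eq_vw : v = w.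
  apply: eq_from_tnth => p; have := congr1 (fun t => (tnth t p).1) eq_fill.
  by rewrite !tnth_mktuple.
split=> //; move: eq_fill; rewrite {v}eq_vw => eq_fill.
(* [h (a, j)] is the position holding occurrence [j] of [a], where the [j]-th letter of the inner
   word is written. *)
apply: eq_from_tnth => j; have [h _ hK] := slot_bij n_gt0 w_count L_eq.
have := congr1 (fun t => (tnth t (h (a, j))).2) eq_fill.
by rewrite !tnth_mktuple hK.
Qed.

Lemma FPA_subset (lam n d : nat) (A : finType) (F G : {set n.-tuple A}) :
  G \subset F -> is_FPA lam d F -> is_FPA lam d G.
Proof.
move=> /subsetP sGF [lam_n cardA F_perm F_dist]; split=> // [w /sGF|u v /sGF uF].
  exact: F_perm.
by move=> /sGF; apply: F_dist.
Qed.

Lemma subset_of_card (I : finType) (X : {set I}) (k : nat) :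
  k <= #|X| -> exists2 Y : {set I}, Y \subset X & #|Y| = k.
Proof.
move=> k_le; exists [set x in take k (enum X)].
  by apply/subsetP => x; rewrite inE => /mem_take; rewrite mem_enum.
rewrite cardsE (card_uniqP _) ?take_uniq ?enum_uniq //.
by rewrite size_take_min -cardE; apply/minn_idPl.
Qed.

Lemma FPA_fill (lam b n d c : nat) (A B : finType)
    (F : {set n.-tuple A}) (C : {set (b * n).-tuple B}) :
  0 < b -> 0 < n -> b * d <= c -> is_FPA lam d F -> is_FPA n c C ->
  exists T : {set (b * n).-tuple (B * A)},
    is_FPA lam (b * d) T /\ #|T| = #|C| * #|F|.
Proof.
move=> b_gt0 n_gt0 c_ge [lam_n cardA F_perm F_dist] [_ cardB C_perm C_dist].
have {}cardB : #|B| = b by rewrite cardB mulnK.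
have L_eq : b * n = #|B| * n by rewrite cardB.
have C_count w : w \in C -> forall a, count_mem a w = n.
  by move=> /C_perm[].
have lam_bn : lam %| b * n by rewrite dvdn_mull.
have cardBA : #|{: B * A}| = b * n %/ lam.
  by rewrite card_prod cardB cardA muln_divA.
exists [set fill n_gt0 q.1 q.2 | q in setX C F]; split.
  split=> // [_ /imsetP[[w f] /setXP[/= wC fF] ->]|].
    split=> // -[a x]; rewrite (count_fill _ _ _ _ (C_count w wC) L_eq).
    by have [_ _ ->] := F_perm f fF.
  move=> _ _ /imsetP[[w f] /setXP[/= wC fF] ->] /imsetP[[v g]
    /setXP[/= vC gF] ->] neq.
  (* Distinct outer words are already at distance [c] or more; equal ones force distinct inner
     words, whose distance is multiplied by [b]. *)
  have [eq_wv|neq_wv] := eqVneq w v; last first.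
    apply: leq_trans (hamming_fill_ge _ _ _ _ _).
    by apply: leq_trans c_ge _; apply: C_dist.
  rewrite -eq_wv (hamming_fill_same _ _ _ (C_count w wC) L_eq) cardB.
  rewrite leq_mul2l F_dist ?orbT //.
  by apply: contraNneq neq => ->; rewrite eq_wv.
rewrite card_in_imset ?cardsX // => -[w f] [v g] _ /setXP[/= vC _] eq_fill.
by have [|-> ->] := fill_inj _ (C_count v vC) L_eq eq_fill; rewrite ?cardB.
Qed.

Theorem theorem4p4 (m lam b n d c N : nat)
  (m_gt0 : 0 < m) (lam_gt0 : 0 < lam) (b_gt0 : 0 < b) (n_eq : n = m * lam)
  (A : 'I_b -> finType) (F : forall i : 'I_b, {set n.-tuple (A i)})
  (F_FPA : forall i : 'I_b, is_FPA lam d (F i))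
  (B : finType) (C : {set (b * n).-tuple B})
  (C_FPA : is_FPA n c C) (C_size : #|C| = N) (c_ge : b * d <= c) :
  exists (S : finType) (T : {set (b * n).-tuple S}),
    is_FPA lam (b * d) T /\
    #|T| = N * \big[minn/#|F (Ordinal b_gt0)|]_(i < b) #|F i|.
Proof.
set M := \big[minn/_]_(i < b) _; pose i0 := Ordinal b_gt0.
have n_gt0 : 0 < n by rewrite n_eq muln_gt0 m_gt0.
have M_le : M <= #|F i0|.
  by rewrite /M; elim/big_rec: _ => // i k _; apply: leq_trans (geq_minr _ _).
(* [F i0] may have more than [M] words; it is cut down to exactly [M], so that the size is an
   equality. *)
have [G sGF <-] := subset_of_card M_le; rewrite -C_size.
have G_FPA := FPA_subset sGF (F_FPA i0).
by exists (B * A i0)%type; apply: FPA_fill b_gt0 n_gt0 c_ge G_FPA C_FPA.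
Qed.
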